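(* Let $m,n$ be nonnegative integers, let $a_{-n},\dots,a_m$ be real numbers, and let $A$ be the $(m+1)\times(n+1)$ Toeplitz matrix whose $(i,j)$ entry is $a_{i-j}$ for $1\le i\le m+1$, $1\le j\le n+1$. Then the single entry of the $1\times 1$ matrix $\sigma_{\downarrow}^{m}\sigma_{\rightarrow}^{n}(A)$ is $$\sum_{k=-n}^{m}\binom{m+n}{n+k}a_k.$$
   Context: For a real $M\times N$ matrix $B=(b_{i,j})$ with $M\ge 2$, $\sigma_{\downarrow}(B)$ is the $(M-1)\times N$ matrix with entries $\sigma_{\downarrow}(B)_{i,j}=b_{i,j}+b_{i+1,j}$; if $N\ge 2$, $\sigma_{\rightarrow}(B)$ is the $M\times(N-1)$ matrix with entries $\sigma_{\rightarrow}(B)_{i,j}=b_{i,j}+b_{i,j+1}$. The powers $\sigma_{\downarrow}^s$ (for $0\le s<M$) and $\sigma_{\rightarrow}^s$ (for $0\le s<N$) denote $s$-fold iteration, with the zeroth power being the identity. *)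

(* Defs.v *)
From mathcomp Require Import all_boot all_order all_algebra.
From mathcomp Require Import reals.

Set Implicit Arguments.
Unset Strict Implicit.
Unset Printing Implicit Defensive.

Import Order.TTheory GRing.Theory Num.Theory.

Local Open Scope ring_scope.

(* The rows i and i + 1 of an M.+1-row matrix, for i : 'I_M, are the rows
   widen_ord _ i and lift ord0 i.  When M = 0 the result is the empty matrix. *)
Definition sigma_down (R : realType) (M N : nat) (B : 'M[R]_(M.+1, N)) :
    'M[R]_(M, N) :=
  \matrix_(i < M, j < N) (B (widen_ord (leqnSn M) i) j + B (lift ord0 i) j).

Definition sigma_right (R : realType) (M N : nat) (B : 'M[R]_(M, N.+1)) :
    'M[R]_(M, N) :=
  \matrix_(i < M, j < N) (B i (widen_ord (leqnSn N) j) + B i (lift ord0 j)).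

(* The size of the source is written s + M, so that s.+1 + M is convertible to
   (s + M).+1 and no cast between matrix types is needed. *)
Fixpoint sigma_down_iter (R : realType) (s M N : nat) :
    'M[R]_(s + M, N) -> 'M[R]_(M, N) :=
  if s is s'.+1 then fun B : 'M[R]_((s' + M).+1, N) =>
    sigma_down_iter (sigma_down B)
  else id.

Arguments sigma_down_iter {R} s {M N} _.

Fixpoint sigma_right_iter (R : realType) (s M N : nat) :
    'M[R]_(M, s + N) -> 'M[R]_(M, N) :=
  if s is s'.+1 then fun B : 'M[R]_(M, (s' + N).+1) =>
    sigma_right_iter (sigma_right B)
  else id.

Arguments sigma_right_iter {R} s {M N} _.

(* Indices start at 0 here; only the difference i - j matters. *)
Definition toeplitz (R : realType) (M N : nat) (a : int -> R) : 'M[R]_(M, N) :=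
  \matrix_(i < M, j < N) a (i%:Z - j%:Z).

(* The integers -n, -n + 1, ..., m in increasing order. *)
Definition int_range (n m : nat) : seq int :=
  [seq i%:Z - n%:Z | i <- iota 0 (m + n).+1].

Lemma mem_int_range (n m : nat) (k : int) :
  (k \in int_range n m) = (- n%:Z <= k <= m%:Z).
Proof.
apply/mapP/andP => [[i] | [nk km]].
  rewrite mem_iota /= add0n ltnS => im ->; split.
    by rewrite lerDr.
  by rewrite lerBlDr -PoszD lez_nat.
have kn0 : 0 <= k + n%:Z by rewrite -lerBlDr sub0r.
exists (absz (k + n%:Z)); last by rewrite gez0_abs // addrK.
by rewrite mem_iota /= add0n ltnS -lez_nat gez0_abs // PoszD lerD2r.
Qed.

Lemma int_range_uniq (n m : nat) : uniq (int_range n m).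
Proof.
by rewrite map_inj_uniq ?iota_uniq // => i j /addIr [].
Qed.

(* Main.v *)
(* Both operators preserve Toeplitz matrices: with T a x = a x + a (x + 1), the
   symbol a becomes T a under sigma_down, and T a shifted by -1 under
   sigma_right.  Since T commutes with shifts, the entry sought is the value of
   T^(m+n) a at -n, which the binomial formula for T^s expands. *)
Require Import Defs.
From mathcomp Require Import all_boot all_order all_algebra.
From mathcomp Require Import reals.

Set Implicit Arguments.
Unset Strict Implicit.
Unset Printing Implicit Defensive.

Import Order.TTheory GRing.Theory Num.Theory.

Local Open Scope ring_scope.

Definition add_shift (V : nmodType) (a : int -> V) (x : int) : V :=
  a x + a (x + 1).

(** Lets the shifts by -1 that [sigma_right] produces be pulled out of the iterates. *)
Lemma iter_add_shift_translate (V : nmodType) (s : nat) (a : int -> V)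
    (c x : int) :
  iter s (@add_shift V) (fun y => a (y + c)) x = iter s (@add_shift V) a (x + c).
Proof. by elim: s x => //= s IHs x; rewrite /add_shift !IHs addrAC. Qed.

(** Induction on [s] by Pascal's rule, applied to every term but the one at index 0. *)
Lemma iter_add_shiftE (V : nmodType) (s : nat) (a : int -> V) (x : int) :
  iter s (@add_shift V) a x = \sum_(i < s.+1) a (x + i%:Z) *+ 'C(s, i).
Proof.
elim: s x => [|s IHs] x; first by rewrite big_ord1 addr0.
rewrite iterS {1}/add_shift !IHs.
rewrite [RHS]big_ord_recl bin0 [in RHS](eq_bigr (fun i : 'I_s.+1 =>
  a (x + i.+1%:Z) *+ 'C(s, i.+1) + a (x + 1 + i%:Z) *+ 'C(s, i))); last first.
  by move=> i _; rewrite lift0 binS mulrnDr -[in RHS]addrA -intS.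
rewrite big_split /= addrA; congr (_ + _).
(* The top term carries ['C(s, s.+1)], which is 0. *)
by rewrite [in RHS]big_ord_recr /= bin_small // mulr0n !addr0 big_ord_recl bin0 addr0.
Qed.

Section Toeplitz.

Variable R : realType.
Implicit Type a b : int -> R.

Lemma eq_toeplitz (M N : nat) a b : a =1 b -> toeplitz M N a = toeplitz M N b.
Proof. by move=> eq_ab; apply/matrixP=> i j; rewrite !mxE. Qed.

Lemma sigma_down_toeplitz (M N : nat) a :
  sigma_down (toeplitz M.+1 N a) = toeplitz M N (add_shift a).
Proof.
by apply/matrixP=> i j; rewrite !mxE lift0 intS [1 + _]addrC [_ + 1 - _]addrAC.
Qed.

(** Moving one column right lowers [i - j] by 1, so the two summands are [a] at [x - 1] and at
    [x]. *)
Lemma sigma_right_toeplitz (M N : nat) a :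
  sigma_right (toeplitz M N.+1 a) =
  toeplitz M N (fun x => add_shift a (x - 1)).
Proof.
apply/matrixP=> i j; rewrite !mxE lift0 /add_shift subrK addrC intS.
by rewrite opprD addrA [_ - 1 - _]addrAC.
Qed.

Lemma sigma_down_iter_toeplitz (s M N : nat) a :
  sigma_down_iter s (toeplitz (s + M) N a) =
  toeplitz M N (iter s (@add_shift R) a).
Proof.
elim: s a => //= s IHs a.
by rewrite sigma_down_toeplitz IHs -iterSr.
Qed.

Lemma sigma_right_iter_toeplitz (s M N : nat) a :
  sigma_right_iter s (toeplitz M (s + N) a) =
  toeplitz M N (fun x => iter s (@add_shift R) a (x - s%:Z)).
Proof.
elim: s a => [|s IHs] a /=.
  by apply: eq_toeplitz => x; rewrite subr0.
rewrite sigma_right_toeplitz IHs; apply: eq_toeplitz => x.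
by rewrite iter_add_shift_translate -iterSr intS [1 + _]addrC opprD addrA.
Qed.

End Toeplitz.

(* The sequence a is given on all of int; only its values on [-n, m] occur.
   On this range n + k >= 0, so the absolute value is n + k as a nat. *)
Theorem proposition4p3 (R : realType) (m n : nat) (a : int -> R) :
  sigma_down_iter m (sigma_right_iter n (toeplitz (m + 1) (n + 1) a)) ord0 ord0 =
  \sum_(k <- int_range n m) 'C(m + n, absz (n%:Z + k))%:R * a k.
Proof.
rewrite sigma_right_iter_toeplitz sigma_down_iter_toeplitz mxE subrr.
rewrite iter_add_shift_translate -iterD iter_add_shiftE.
(* Reindexing by [k = i - n] turns [n + k] into the binomial index [i]. *)
rewrite /int_range big_map -[iota _ _]/(index_iota 0 (m + n).+1) big_mkord.
apply: eq_bigr => i _.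
by rewrite add0r addrC [n%:Z + _]addrC subrK mulr_natl.
Qed.
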